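(* Let $A$ be a finite abelian group. As an algebra object of $\mathrm{Rep}(C(A))$, the twisted group algebra $\mathcal{A}=\mathbb{C}_{\beta_A}[V_A]$ is isomorphic to $\mathcal{F}(\mathbb{C}[V_A])$. Writing $m$ for the multiplication of $\mathbb{C}[V_A]$, the transported multiplication $m_{\mathcal{F}}:=\mathcal{F}(m)\circ J_{\mathbb{C}[V_A],\mathbb{C}[V_A]}$ is $$m_{\mathcal{F}}(\delta_v\otimes\delta_w)=\beta_A(v,w)\,\delta_{v+w}.$$ Under $\delta_v\leftrightarrow u_v$, this is the product $u_vu_w=\beta_A(v,w)u_{v+w}$ of $\mathcal{A}$; the transported action is then $\alpha_g(u_v)=\lambda(v)u_{Tv}$ for $g=(T,\lambda)\in C(A)$.
   Context: **Setting.** $A$ is a finite abelian group, written additively; $\widehat{A}=\mathrm{Hom}(A,U(1))$; $V_A=A\oplus\widehat{A}$ (written additively); $\widehat{V_A}=\mathrm{Hom}(V_A,U(1))$. Put $\beta_A((a,\chi),(b,\psi))=\chi(b)$ and $\omega_A(u,v)=\beta_A(u,v)\beta_A(v,u)^{-1}$; $\mathrm{Sp}(V_A)=\{T\in\mathrm{Aut}(V_A):\omega_A(Tu,Tv)=\omega_A(u,v)\ \forall u,v\}$. **Projective Clifford group.** Let $\mathcal{H}=\mathbb{C}[A]$ with orthonormal basis $|b\rangle$, $b\in A$; for $v=(a,\chi)\in V_A$ let $W_v|b\rangle=\chi(b)|a+b\rangle$; $H(A)=\{zW_v:z\in U(1),v\in V_A\}$ and $C(A)=N_{U(\mathcal{H})}(H(A))/(U(1)\cdot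 I)$. Throughout, $C(A)$ is identified (by a known isomorphism) with the group of pairs $(T,\lambda)$, $T\in\mathrm{Aut}(V_A)$, $\lambda:V_A\to U(1)$ a function, satisfying $\lambda(u+v)\lambda(u)^{-1}\lambda(v)^{-1}=\beta_A(Tu,Tv)\beta_A(u,v)^{-1}$ for all $u,v$, with product $(T,\lambda)(S,\mu)=(TS,\lambda^S\mu)$, $\lambda^S(u)=\lambda(Su)$; $(T,\lambda)$ corresponds to the class of any unitary $U$ with $UW_uU^\dagger=\lambda(u)W_{Tu}$ for all $u$. Necessarily $T\in\mathrm{Sp}(V_A)$ (known: the projection to $\mathrm{Sp}(V_A)$ is onto). **Affine symplectic group and functor $\mathcal{F}$.** $\mathrm{ASp}(A)=\{(T,\chi):T\in\mathrm{Sp}(V_A),\chi\in\widehat{V_A}\}$ with $(T,\chi)(S,\psi)=(TS,\chi^S\psi)$, $\chi^S(v)=\chi(Sv)$. $\mathrm{Rep}(G)$ is the tensor category of finite-dimensional complex representations. For a representation $(U,\pi)$ of $\mathrm{ASp}(A)$ put $U_v=\{\xi\in U:\pi(\mathrm{id},\chi)\xi=\chi(v)\xi\ \forall\chi\in\widehat{V_A}\}$ and $\rho(T)=\pi(T,1)$; then $U=\bigoplus_{v\in V_A}U_v$ and $\rho(T)U_v\subseteq U_{Tv}$. $\mathcal{F}:\mathrm{Rep}(\mathrm{ASp}(A))\to\mathrm{Rep}(C(A))$ sends $U$ to the same vector space with $C(A)$-action $(T,\lambda)\cdot\xi=\lambda(v)\rho(T)\xi$ for $\xi\in U_v$, is the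 identity on morphisms, and has tensor structure $J_{U,W}:\mathcal{F}(U)\otimes\mathcal{F}(W)\to\mathcal{F}(U\otimes W)$, $J_{U,W}(\xi\otimes\eta)=\beta_A(v,w)\,\xi\otimes\eta$ for $\xi\in U_v,\eta\in W_w$. **Algebras.** $\mathbb{C}[V_A]$ has basis $\{\delta_v\}_{v\in V_A}$, multiplication $\delta_v\delta_w=\delta_{v+w}$, and $\mathrm{ASp}(A)$-action $(T,\chi)\cdot\delta_v=\chi(v)\delta_{Tv}$ by algebra automorphisms. $\mathcal{A}=\mathbb{C}_{\beta_A}[V_A]$ has basis $\{u_v\}_{v\in V_A}$, multiplication $u_vu_w=\beta_A(v,w)u_{v+w}$, and $C(A)$-action by algebra automorphisms $\alpha_g(u_v)=\lambda(v)u_{Tv}$ for $g=(T,\lambda)$. *)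

(* Defs.v *)
From HB Require Import structures.
From mathcomp Require Import all_boot all_order all_algebra all_fingroup.
From mathcomp Require Import boolp cyclic cyclotomic separable.

Set Implicit Arguments.
Unset Strict Implicit.
Unset Printing Implicit Defensive.

Import Order.TTheory GRing.Theory Num.Theory.
Local Open Scope ring_scope.

(* C stands for the complex numbers; U(1) is the set of z with `|z| = 1. *)

Section Dual.
Variables (C : numClosedFieldType) (A : finZmodType).

Definition is_char (f : {ffun A -> C}) : bool :=
  [forall a, `|f a| == 1] && [forall a, forall b, f (a + b) == f a * f b].

(* Hom(A, U(1)), written additively. *)
Record dual : Type := Dual { dual_val :> {ffun A -> C}; dual_valP : is_char dual_val }.

HB.instance Definition _ := [isSub for dual_val].
HB.instance Definition _ := [Choice of dual by <:].

Implicit Types chi psi : dual.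

Lemma char_norm chi a : `|chi a| = 1.
Proof. by case: chi => f /= /andP[/forallP/(_ a)/eqP]. Qed.

Lemma charD chi a b : chi (a + b) = chi a * chi b.
Proof. by case: chi => f /= /andP[_ /forallP/(_ a)/forallP/(_ b)/eqP]. Qed.

Lemma char_neq0 chi a : chi a != 0.
Proof. by rewrite -normr_eq0 char_norm oner_eq0. Qed.

Lemma char0 chi : chi 0 = 1.
Proof.
by apply: (mulfI (char_neq0 chi 0)); rewrite -charD addr0 mulr1.
Qed.

Lemma charN chi a : chi (- a) = (chi a)^-1.
Proof.
by apply: (mulfI (char_neq0 chi a)); rewrite -charD addrN char0 divff ?char_neq0.
Qed.

Lemma charMn chi a n : chi (a *+ n) = chi a ^+ n.
Proof. by elim: n => [|n IH]; rewrite ?char0 // mulrS charD IH exprS. Qed.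

Lemma is_charP (f : {ffun A -> C}) :
  (forall a, `|f a| = 1) -> (forall a b, f (a + b) = f a * f b) -> is_char f.
Proof.
move=> f1 fD; apply/andP; split; first by apply/forallP => a; rewrite f1.
by apply/forallP => a; apply/forallP => b; rewrite fD.
Qed.

Lemma mulrn_card (a : A) : a *+ #|A| = 0.
Proof.
by have := @expg_cardG A [set: A]%G a (in_setT _); rewrite cardsT.
Qed.

(* Character values are #|A|-th roots of unity, so there are finitely many. *)
Definition unity_roots : seq C :=
  projT1 (@closed_field_poly_normal C ('X^#|A| - 1)).

Lemma unity_rootsE : 'X^#|A| - 1 = \prod_(z <- unity_roots) ('X - z%:P).
Proof.
rewrite /unity_roots; case: closed_field_poly_normal => r /= Er.
have n0 : (0 < #|A|)%N by apply/card_gt0P; exists 0.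
by rewrite {1}Er -polyC1 lead_coefXnsubC // scale1r.
Qed.

Lemma char_unity_root chi a : chi a \in unity_roots.
Proof.
rewrite -root_prod_XsubC -unity_rootsE.
by rewrite /root !hornerE -charMn mulrn_card char0 subrr.
Qed.

Definition dual_encode chi : {ffun A -> 'I_(size unity_roots).+1} :=
  [ffun a => inord (index (chi a) unity_roots)].

Definition dual_decode (g : {ffun A -> 'I_(size unity_roots).+1}) : option dual :=
  insub [ffun a => nth 0 unity_roots (g a)].

Lemma dual_encodeK : pcancel dual_encode dual_decode.
Proof.
move=> chi; rewrite /dual_decode.
suff -> : [ffun a => nth 0 unity_roots (dual_encode chi a)] = val chi by rewrite valK.
apply/ffunP => a; rewrite !ffunE inordK ?nth_index ?char_unity_root //.
by rewrite ltnS index_size.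
Qed.

HB.instance Definition _ := PCanIsCountable dual_encodeK.
HB.instance Definition _ : isFinite dual := PCanIsFinite dual_encodeK.

Lemma dual_zero_subproof : is_char [ffun=> 1].
Proof. by apply: is_charP => *; rewrite !ffunE ?normr1 ?mulr1. Qed.
Lemma dual_opp_subproof chi : is_char [ffun a => (chi a)^-1].
Proof.
by apply: is_charP => *; rewrite !ffunE ?normfV ?char_norm ?invr1 // charD invfM.
Qed.
Lemma dual_add_subproof chi psi : is_char [ffun a => chi a * psi a].
Proof.
apply: is_charP => *; rewrite !ffunE ?normrM ?char_norm ?mulr1 //.
by rewrite !charD mulrACA.
Qed.

Definition dual_zero := Dual dual_zero_subproof.
Definition dual_opp chi := Dual (dual_opp_subproof chi).
Definition dual_add chi psi := Dual (dual_add_subproof chi psi).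

Lemma dual_eqP chi psi : (forall a, chi a = psi a) -> chi = psi.
Proof. by move=> E; apply/val_inj/ffunP. Qed.

Lemma dual_addA : associative dual_add.
Proof. by move=> x y z; apply: dual_eqP => a; rewrite /= !ffunE mulrA. Qed.
Lemma dual_addC : commutative dual_add.
Proof. by move=> x y; apply: dual_eqP => a; rewrite /= !ffunE mulrC. Qed.
Lemma dual_add0 : left_id dual_zero dual_add.
Proof. by move=> x; apply: dual_eqP => a; rewrite /= !ffunE mul1r. Qed.
Lemma dual_addN : left_inverse dual_zero dual_opp dual_add.
Proof. by move=> x; apply: dual_eqP => a; rewrite /= !ffunE mulVf ?char_neq0. Qed.

HB.instance Definition _ :=
  GRing.isZmodule.Build dual dual_addA dual_addC dual_add0 dual_addN.

Lemma dual0E a : (0 : dual) a = 1. Proof. by rewrite ffunE. Qed.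
Lemma dualDE chi psi a : (chi + psi) a = chi a * psi a. Proof. by rewrite ffunE. Qed.
Lemma dualNE chi a : (- chi) a = (chi a)^-1. Proof. by rewrite ffunE. Qed.

End Dual.

Definition VA (C : numClosedFieldType) (A : finZmodType) : Type := (A * dual C A)%type.
HB.instance Definition _ C A := GRing.Zmodule.on (VA C A).
HB.instance Definition _ C A := Finite.on (VA C A).

(* Characters separate points: simultaneously diagonalize the translations. *)
Section Separation.
Variables (C : numClosedFieldType) (A : finZmodType).

Let n := #|A|.-1.
Let cardA : n.+1 = #|A|.
Proof. by rewrite prednK //; apply/card_gt0P; exists 0. Qed.
Let e (i : 'I_n.+1) : A := enum_val (cast_ord cardA i).
Let e' (a : A) : 'I_n.+1 := cast_ord (esym cardA) (enum_rank a).
Let eK a : e (e' a) = a.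
Proof. by rewrite /e /e' cast_ordKV enum_rankK. Qed.
Let eI i j : (e i == e j) = (i == j).
Proof. by rewrite /e (inj_eq enum_val_inj) (inj_eq (@cast_ord_inj _ _ _)). Qed.
Let T (a : A) : 'M[C]_n.+1 := \matrix_(i, j) (e i + a == e j)%:R.

Let TM a b : T a *m T b = T (a + b).
Proof.
apply/matrixP => i k; rewrite !mxE (bigD1 (e' (e i + a))) //= !mxE eK eqxx mul1r.
rewrite big1 ?addr0 ?addrA // => j ne; rewrite !mxE.
case: eqP => [E|_]; last by rewrite mul0r.
by case/eqP: ne; apply/eqP; rewrite -eI eK E.
Qed.

Let T0 : T 0 = 1%:M.
Proof. by apply/matrixP => i j; rewrite !mxE addr0 eI. Qed.

Let TX a m : T a ^+ m = T (a *+ m).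
Proof. by elim: m => [|m IH]; rewrite ?T0 // exprS IH mulrS -TM. Qed.

Let Tdiag a : diagonalizable (T a).
Proof.
apply/diagonalizableP; exists (unity_roots C A).
  rewrite -separable_prod_XsubC -unity_rootsE separable_Xn_sub_1 //.
  by rewrite pnatr_eq0 -cardA.
apply: mxminpoly_min; rewrite -unity_rootsE rmorphB rmorphXn rmorph1 /= horner_mx_X.
by rewrite TX mulrn_card T0 subrr.
Qed.

Lemma char_separate (a : A) : a != 0 -> exists chi : dual C A, chi a != 1.
Proof.
move=> a0.
have [] := (@codiagonalizableP C n.+1 [seq T b | b <- enum A]).1.
  split=> [_ _ /mapP[b _ ->] /mapP[c _ ->]|_ /mapP[b _ ->]]; last exact: Tdiag.
  by rewrite /comm_mx !TM addrC.
move=> P Pu /allP TP.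
pose D b := P *m T b *m invmx P.
have Dd b : is_diag_mx (D b).
  have bA : T b \in [seq T b | b <- enum A] by rewrite map_f ?mem_enum.
  by rewrite /D -conjumx //; have := TP _ bA.
have D0 : D 0 = 1%:M by rewrite /D T0 mulmx1 mulmxV.
have DM b c : D b *m D c = D (b + c).
  by rewrite /D -TM !mulmxA mulmxKV.
have DE i b c : D (b + c) i i = D b i i * D c i i.
  rewrite -DM mxE (bigD1 i) //= big1 ?addr0 // => j ne.
  by rewrite (is_diag_mxP (Dd b)) ?mul0r // eq_sym.
have DX i b m : D (b *+ m) i i = D b i i ^+ m.
  elim: m => [|m IH]; first by rewrite mulr0n D0 mxE eqxx.
  by rewrite mulrS DE IH exprS.
have D1 i b : `|D b i i| = 1.
  apply/eqP; rewrite -(@pexpr_eq1 _ _ n.+1) // -normrX -DX.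
  have -> : b *+ n.+1 = 0 by rewrite cardA mulrn_card.
  by rewrite D0 mxE eqxx normr1.
have chiP i : is_char [ffun b => D b i i].
  by apply: is_charP => *; rewrite !ffunE.
have [/forallP H|] := boolP [forall i, D a i i == 1]; last first.
  rewrite negb_forall => /existsP[i ne]; exists (Dual (chiP i)).
  by rewrite ffunE.
have Da1 : D a = 1%:M.
  apply/matrixP => i j; have [->|ne] := eqVneq i j.
    by rewrite (eqP (H _)) mxE eqxx.
  by rewrite [RHS]mxE (is_diag_mxP (Dd a)) // (negPf ne).
have Ta : T a = 1%:M.
  have : invmx P *m D a *m P = T a by rewrite /D !mulmxA mulVmx // mul1mx mulmxKV.
  by rewrite Da1 mulmx1 mulVmx.
case/eqP: a0; apply/eqP.
have := congr1 (fun M : 'M_n.+1 => M (e' 0) (e' 0)) Ta.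
rewrite !mxE !eqxx !eK add0r; case: (a == 0) => // /eqP.
by rewrite eq_sym oner_eq0.
Qed.

Lemma sum_char (chi : dual C A) :
  \sum_(a : A) chi a = if chi == 0 then #|A|%:R else 0.
Proof.
have [->|nz] := eqVneq.
  by under eq_bigr do rewrite dual0E; rewrite sumr_const.
have [a ca] : exists a, chi a != 1.
  apply/existsP; rewrite -negb_forall; apply: contra nz => /forallP H.
  by apply/eqP/dual_eqP => a; rewrite dual0E (eqP (H a)).
apply/eqP; set s := \sum_a _; have Es : s = chi a * s.
  rewrite {1}/s (reindex_inj (addrI a)) /= mulr_sumr.
  by apply: eq_bigr => b _; rewrite charD.
have /eqP : (1 - chi a) * s = 0 by rewrite mulrBl mul1r -Es subrr.
by rewrite mulf_eq0 subr_eq0 eq_sym (negPf ca).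
Qed.

Lemma sum_dual (a : A) :
  \sum_(chi : dual C A) chi a = if a == 0 then #|{: dual C A}|%:R else 0.
Proof.
have [->|nz] := eqVneq.
  by under eq_bigr do rewrite char0; rewrite sumr_const.
have [psi ca] := char_separate nz.
apply/eqP; set s := \sum_chi _; have Es : s = psi a * s.
  rewrite {1}/s (reindex_inj (addrI psi)) /= mulr_sumr.
  by apply: eq_bigr => b _; rewrite dualDE.
have /eqP : (1 - psi a) * s = 0 by rewrite mulrBl mul1r -Es subrr.
by rewrite mulf_eq0 subr_eq0 eq_sym (negPf ca).
Qed.

Lemma card_dual : #|{: dual C A}| = #|A|.
Proof.
apply/eqP; rewrite -(eqr_nat C); apply/eqP.
have <- : \sum_(a : A) \sum_(chi : dual C A) chi a = #|{: dual C A}|%:R.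
  under eq_bigr do rewrite sum_dual.
  by rewrite -big_mkcond /= big_pred1_eq.
rewrite exchange_big /=; under eq_bigr do rewrite sum_char.
by rewrite -big_mkcond /= big_pred1_eq.
Qed.

End Separation.

Section Automorphisms.
Variable V : finZmodType.

(* Additive automorphisms; the product is T S = T \o S, which is opposite to
   the product of {perm V}. *)
Definition is_zaut (T : {perm V}) : bool :=
  [forall u, forall v, T (u + v) == T u + T v].

Record zaut : Type := ZAut { zaut_perm :> {perm V}; zaut_permP : is_zaut zaut_perm }.

HB.instance Definition _ := [isSub for zaut_perm].
HB.instance Definition _ := [Choice of zaut by <:].

Implicit Types T S : zaut.

Lemma zautD T u v : T (u + v) = T u + T v.
Proof. by case: T => t /= /forallP/(_ u)/forallP/(_ v)/eqP. Qed.

Lemma is_zautP (t : {perm V}) : (forall u v, t (u + v) = t u + t v) -> is_zaut t.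
Proof. by move=> tD; apply/forallP => u; apply/forallP => v; rewrite tD. Qed.

Lemma zaut_one_subproof : is_zaut 1%g.
Proof. by apply: is_zautP => u v; rewrite !perm1. Qed.
Lemma zaut_mul_subproof T S : is_zaut (val S * val T)%g.
Proof. by apply: is_zautP => u v; rewrite !permM !zautD. Qed.
Lemma zaut_inv_subproof T : is_zaut (val T)^-1%g.
Proof.
by apply: is_zautP => u v; apply: (@perm_inj _ T); rewrite zautD !permKV.
Qed.

Definition zaut_one := ZAut zaut_one_subproof.
Definition zaut_mul T S := ZAut (zaut_mul_subproof T S).
Definition zaut_inv T := ZAut (zaut_inv_subproof T).

Lemma zaut_mulA : associative zaut_mul.
Proof. by move=> x y z; apply: val_inj; rewrite /= mulgA. Qed.
Lemma zaut_mul1 : left_id zaut_one zaut_mul.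
Proof. by move=> x; apply: val_inj; rewrite /= mulg1. Qed.
Lemma zaut_1mul : right_id zaut_one zaut_mul.
Proof. by move=> x; apply: val_inj; rewrite /= mul1g. Qed.
Lemma zaut_mulV : left_inverse zaut_one zaut_inv zaut_mul.
Proof. by move=> x; apply: val_inj; rewrite /= mulgV. Qed.
Lemma zaut_Vmul : right_inverse zaut_one zaut_inv zaut_mul.
Proof. by move=> x; apply: val_inj; rewrite /= mulVg. Qed.

HB.instance Definition _ :=
  isGroup.Build zaut zaut_mulA zaut_mul1 zaut_1mul zaut_mulV zaut_Vmul.

Lemma zaut1E v : (1%g : zaut) v = v. Proof. exact: perm1. Qed.
Lemma zautME T S v : (T * S)%g v = T (S v). Proof. exact: permM. Qed.
Lemma zautKV T v : T (T^-1%g v) = v. Proof. exact: permKV. Qed.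
Lemma zautK T v : T^-1%g (T v) = v. Proof. exact: permK. Qed.
Lemma zaut0 T : T 0 = 0.
Proof. by apply: (@addrI _ (T 0)); rewrite -zautD !addr0. Qed.
Lemma zautN T v : T (- v) = - T v.
Proof. by apply: (@addrI _ (T v)); rewrite -zautD !subrr zaut0. Qed.

Lemma zaut_eqP T S : T =1 S -> T = S.
Proof. by move=> E; apply/val_inj/permP. Qed.

End Automorphisms.

Section Groups.
Variables (C : numClosedFieldType) (A : finZmodType).
Local Notation V := (VA C A).

Definition beta (u v : V) : C := u.2 v.1.
Definition omega (u v : V) : C := beta u v * (beta v u)^-1.

Lemma betaDl u v w : beta (u + v) w = beta u w * beta v w.
Proof. exact: dualDE. Qed.
Lemma betaDr u v w : beta u (v + w) = beta u v * beta u w.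
Proof. exact: charD. Qed.
Lemma beta0l v : beta 0 v = 1. Proof. exact: dual0E. Qed.
Lemma beta0r v : beta v 0 = 1. Proof. exact: char0. Qed.
Lemma beta_neq0 u v : beta u v != 0. Proof. exact: char_neq0. Qed.
Lemma beta_norm u v : `|beta u v| = 1. Proof. exact: char_norm. Qed.

Definition is_symplectic (T : zaut V) : bool :=
  [forall u, forall v, omega (T u) (T v) == omega u v].

Record sympl : Type := Sympl { sympl_aut :> zaut V; symplP : is_symplectic sympl_aut }.

HB.instance Definition _ := [isSub for sympl_aut].
HB.instance Definition _ := [Choice of sympl by <:].

Lemma is_symplecticP (T : zaut V) :
  reflect (forall u v, omega (T u) (T v) = omega u v) (is_symplectic T).
Proof.
apply: (iffP forallP) => H u; first by move=> v; apply/eqP; move: v; apply/forallP.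
by apply/forallP => v; rewrite H.
Qed.

Lemma sympl_one_subproof : is_symplectic 1%g.
Proof. by apply/is_symplecticP => u v; rewrite !zaut1E. Qed.
Lemma sympl_mul_subproof (T S : sympl) : is_symplectic (val T * val S)%g.
Proof.
by apply/is_symplecticP => u v; rewrite !zautME !(is_symplecticP _ (symplP _)).
Qed.
Lemma sympl_inv_subproof (T : sympl) : is_symplectic (val T)^-1%g.
Proof.
apply/is_symplecticP => u v.
by rewrite -[LHS](is_symplecticP _ (symplP T)) /= !zautKV.
Qed.

Definition sympl_one := Sympl sympl_one_subproof.
Definition sympl_mul T S := Sympl (sympl_mul_subproof T S).
Definition sympl_inv T := Sympl (sympl_inv_subproof T).

Lemma sympl_mulA : associative sympl_mul.
Proof. by move=> x y z; apply: val_inj; rewrite /= mulgA. Qed.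
Lemma sympl_mul1 : left_id sympl_one sympl_mul.
Proof. by move=> x; apply: val_inj; rewrite /= mul1g. Qed.
Lemma sympl_1mul : right_id sympl_one sympl_mul.
Proof. by move=> x; apply: val_inj; rewrite /= mulg1. Qed.
Lemma sympl_mulV : left_inverse sympl_one sympl_inv sympl_mul.
Proof. by move=> x; apply: val_inj; rewrite /= mulVg. Qed.
Lemma sympl_Vmul : right_inverse sympl_one sympl_inv sympl_mul.
Proof. by move=> x; apply: val_inj; rewrite /= mulgV. Qed.

HB.instance Definition _ :=
  isGroup.Build sympl sympl_mulA sympl_mul1 sympl_1mul sympl_mulV sympl_Vmul.

Lemma sympl1E v : (1%g : sympl) v = v. Proof. exact: zaut1E. Qed.
Lemma symplME (T S : sympl) v : (T * S)%g v = T (S v). Proof. exact: zautME. Qed.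
Lemma symplKV (T : sympl) v : T (T^-1%g v) = v. Proof. exact: zautKV. Qed.

Lemma dual_pull_subproof (chi : dual C V) (S : zaut V) : is_char [ffun v => chi (S v)].
Proof.
by apply: is_charP => *; rewrite !ffunE ?char_norm // zautD charD.
Qed.
Definition dual_pull chi S : dual C V := Dual (dual_pull_subproof chi S).

Lemma dual_pullE chi S v : dual_pull chi S v = chi (S v).
Proof. by rewrite ffunE. Qed.

Record asp : Type := Asp { asp_T : sympl; asp_chi : dual C V }.

Definition asp_pair (g : asp) := (asp_T g, asp_chi g).
Definition pair_asp (p : sympl * dual C V) := Asp p.1 p.2.
Lemma asp_pairK : cancel asp_pair pair_asp. Proof. by case. Qed.
HB.instance Definition _ := Choice.copy asp (can_type asp_pairK).

Definition asp_one := Asp 1%g 0.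
Definition asp_mul (g h : asp) :=
  Asp (asp_T g * asp_T h)%g (dual_pull (asp_chi g) (asp_T h) + asp_chi h).
Definition asp_inv (g : asp) :=
  Asp (asp_T g)^-1%g (- dual_pull (asp_chi g) (asp_T g)^-1%g).

Lemma asp_eqP g h : asp_T g = asp_T h ->
  (forall v, asp_chi g v = asp_chi h v) -> g = h.
Proof. by case: g h => [T c] [S d] /= -> E; congr Asp; apply: dual_eqP. Qed.

Lemma asp_chi_mul g h v :
  asp_chi (asp_mul g h) v = asp_chi g (asp_T h v) * asp_chi h v.
Proof. by rewrite dualDE dual_pullE. Qed.
Lemma asp_chi_inv g v : asp_chi (asp_inv g) v = (asp_chi g ((asp_T g)^-1%g v))^-1.
Proof. by rewrite dualNE dual_pullE. Qed.
Lemma asp_chi_one v : asp_chi asp_one v = 1.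
Proof. exact: dual0E. Qed.

Lemma asp_mulA : associative asp_mul.
Proof.
move=> x y z; apply: asp_eqP => [|v]; first exact: mulgA.
by rewrite !asp_chi_mul symplME mulrA.
Qed.
Lemma asp_mul1 : left_id asp_one asp_mul.
Proof.
move=> x; apply: asp_eqP => [|v]; first exact: mul1g.
by rewrite asp_chi_mul asp_chi_one mul1r.
Qed.
Lemma asp_1mul : right_id asp_one asp_mul.
Proof.
move=> x; apply: asp_eqP => [|v]; first exact: mulg1.
by rewrite asp_chi_mul asp_chi_one mulr1 sympl1E.
Qed.
Lemma asp_mulV : left_inverse asp_one asp_inv asp_mul.
Proof.
move=> x; apply: asp_eqP => [|v]; first exact: mulVg.
by rewrite asp_chi_mul asp_chi_inv zautK asp_chi_one mulVf ?char_neq0.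
Qed.
Lemma asp_Vmul : right_inverse asp_one asp_inv asp_mul.
Proof.
move=> x; apply: asp_eqP => [|v]; first exact: mulgV.
by rewrite asp_chi_mul asp_chi_inv asp_chi_one mulfV ?char_neq0.
Qed.

HB.instance Definition _ :=
  isGroup.Build asp asp_mulA asp_mul1 asp_1mul asp_mulV asp_Vmul.

(* The projective Clifford group as the group of pairs (T, lambda): the class of
   a unitary X normalizing the Heisenberg group corresponds to the pair such
   that X W_u X^* = lambda(u) W_{T u} for all u. *)
Definition is_clifford (p : zaut V * {ffun V -> C}) : bool :=
  [forall u, `|p.2 u| == 1] &&
  [forall u, forall v, p.2 (u + v) * (p.2 u)^-1 * (p.2 v)^-1 ==
                       beta (p.1 u) (p.1 v) * (beta u v)^-1].

Record clifford : Type :=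
  Clifford { clifford_pair : zaut V * {ffun V -> C};
             clifford_pairP : is_clifford clifford_pair }.

HB.instance Definition _ := [isSub for clifford_pair].
HB.instance Definition _ := [Choice of clifford by <:].

Definition cl_T (g : clifford) : zaut V := (clifford_pair g).1.
Definition cl_lambda (g : clifford) : {ffun V -> C} := (clifford_pair g).2.

Lemma cl_norm g u : `|cl_lambda g u| = 1.
Proof.
have H : is_clifford (clifford_pair g) by apply: clifford_pairP.
by case/andP: H => /forallP/(_ u)/eqP.
Qed.

Lemma cl_neq0 g u : cl_lambda g u != 0.
Proof. by rewrite -normr_eq0 cl_norm oner_eq0. Qed.

Lemma cl_cocycle g u v :
  cl_lambda g (u + v) * beta u v =
  beta (cl_T g u) (cl_T g v) * cl_lambda g u * cl_lambda g v.
Proof.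
have H : is_clifford (clifford_pair g) by apply: clifford_pairP.
case/andP: H => _ /forallP/(_ u)/forallP/(_ v).
rewrite -/(cl_T g) -/(cl_lambda g) -mulrA -invfM.
by rewrite eqr_div ?mulf_neq0 ?cl_neq0 ?beta_neq0 // mulrA => /eqP.
Qed.

Lemma is_cliffordP (T : zaut V) (l : {ffun V -> C}) :
  (forall u, `|l u| = 1) ->
  (forall u v, l (u + v) * beta u v = beta (T u) (T v) * l u * l v) ->
  is_clifford (T, l).
Proof.
move=> l1 lD; have l0 u : l u != 0 by rewrite -normr_eq0 l1 oner_eq0.
apply/andP; split; first by apply/forallP => u; rewrite /= l1.
apply/forallP => u; apply/forallP => v /=.
by rewrite -mulrA -invfM eqr_div ?mulf_neq0 ?beta_neq0 // mulrA lD.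
Qed.

Lemma clifford_one_subproof : is_clifford (1%g, [ffun=> 1]).
Proof.
by apply: is_cliffordP => *; rewrite !ffunE ?normr1 // !zaut1E !mulr1 mul1r.
Qed.

Lemma clifford_mul_subproof (g h : clifford) :
  is_clifford ((cl_T g * cl_T h)%g,
               [ffun u => cl_lambda g (cl_T h u) * cl_lambda h u]).
Proof.
apply: is_cliffordP => [u|u v]; rewrite !ffunE.
  by rewrite normrM !cl_norm mulr1.
rewrite !zautME zautD -mulrA cl_cocycle mulrA mulrA cl_cocycle.
by rewrite -!mulrA; do 2!congr (_ * _); rewrite mulrCA.
Qed.

Lemma clifford_inv_subproof (g : clifford) :
  is_clifford ((cl_T g)^-1%g, [ffun u => (cl_lambda g ((cl_T g)^-1%g u))^-1]).
Proof.
apply: is_cliffordP => [u|u v]; rewrite !ffunE.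
  by rewrite normfV cl_norm invr1.
have := cl_cocycle g ((cl_T g)^-1%g u) ((cl_T g)^-1%g v).
rewrite !zautKV -zautD => H; apply/eqP.
rewrite -[X in _ == X]mulrA -invfM [X in X == _]mulrC eqr_div ?mulf_neq0 ?cl_neq0 //.
by rewrite mulrA -H mulrC.
Qed.

Definition cl_one := Clifford clifford_one_subproof.
Definition cl_mul g h := Clifford (clifford_mul_subproof g h).
Definition cl_inv g := Clifford (clifford_inv_subproof g).

Lemma cl_eqP g h : cl_T g = cl_T h -> cl_lambda g =1 cl_lambda h -> g = h.
Proof.
case: g h => [[T c] ?] [[S d] ?]; rewrite /cl_T /cl_lambda /= => ET Ec.
by apply: val_inj; rewrite /= ET; congr pair; apply/ffunP.
Qed.

Lemma cl_lambda_mul g h v :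
  cl_lambda (cl_mul g h) v = cl_lambda g (cl_T h v) * cl_lambda h v.
Proof. by rewrite {1}/cl_lambda ffunE. Qed.
Lemma cl_lambda_inv g v :
  cl_lambda (cl_inv g) v = (cl_lambda g ((cl_T g)^-1%g v))^-1.
Proof. by rewrite {1}/cl_lambda ffunE. Qed.
Lemma cl_lambda_one v : cl_lambda cl_one v = 1.
Proof. by rewrite /cl_lambda ffunE. Qed.

Lemma cl_mulA : associative cl_mul.
Proof.
move=> x y z; apply: cl_eqP => [|v]; first exact: mulgA.
by rewrite !cl_lambda_mul zautME mulrA.
Qed.
Lemma cl_mul1 : left_id cl_one cl_mul.
Proof.
move=> x; apply: cl_eqP => [|v]; first exact: mul1g.
by rewrite cl_lambda_mul cl_lambda_one mul1r.
Qed.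
Lemma cl_1mul : right_id cl_one cl_mul.
Proof.
move=> x; apply: cl_eqP => [|v]; first exact: mulg1.
by rewrite cl_lambda_mul cl_lambda_one mulr1 zaut1E.
Qed.
Lemma cl_mulV : left_inverse cl_one cl_inv cl_mul.
Proof.
move=> x; apply: cl_eqP => [|v]; first exact: mulVg.
by rewrite cl_lambda_mul cl_lambda_inv zautK cl_lambda_one mulVf ?cl_neq0.
Qed.
Lemma cl_Vmul : right_inverse cl_one cl_inv cl_mul.
Proof.
move=> x; apply: cl_eqP => [|v]; first exact: mulgV.
by rewrite cl_lambda_mul cl_lambda_inv cl_lambda_one mulfV ?cl_neq0.
Qed.

HB.instance Definition _ :=
  isGroup.Build clifford cl_mulA cl_mul1 cl_1mul cl_mulV cl_Vmul.

Lemma cl_sp_subproof (g : clifford) : is_symplectic (cl_T g).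
Proof.
apply/is_symplecticP => u v; have H1 := cl_cocycle g u v; have := cl_cocycle g v u.
rewrite addrC => H2; rewrite /omega.
apply/eqP; rewrite eqr_div ?beta_neq0 //; apply/eqP.
apply: (mulfI (cl_neq0 g (u + v))); rewrite mulrCA H2 [RHS]mulrA H1 -!mulrA.
by congr (_ * _); rewrite mulrC [X in X * _]mulrC -mulrA.
Qed.

Definition cl_sp (g : clifford) : sympl := Sympl (cl_sp_subproof g).

Lemma cl1_T v : cl_T 1%g v = v. Proof. exact: zaut1E. Qed.
Lemma clM_T g h v : cl_T (g * h)%g v = cl_T g (cl_T h v). Proof. exact: zautME. Qed.
Lemma cl1_lambda v : cl_lambda 1%g v = 1. Proof. exact: cl_lambda_one. Qed.
Lemma clM_lambda g h v :
  cl_lambda (g * h)%g v = cl_lambda g (cl_T h v) * cl_lambda h v.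
Proof. exact: cl_lambda_mul. Qed.
Lemma cl_lambda0 g : cl_lambda g 0 = 1.
Proof.
apply: (mulfI (cl_neq0 g 0)); have := cl_cocycle g 0 0.
by rewrite addr0 zaut0 !beta0l mul1r => <-.
Qed.
Lemma cl_sp1 : cl_sp 1%g = 1%g. Proof. exact: val_inj. Qed.
Lemma cl_spM g h : cl_sp (g * h)%g = (cl_sp g * cl_sp h)%g. Proof. exact: val_inj. Qed.

End Groups.

Section Tensor.
Import VectorInternalTheory.
Variable C : fieldType.
Implicit Types U W X : vectType C.

(* The tensor product of two vectTypes, as coordinate matrices; [tens_liftE]
   and [tens_ext] are its universal property. *)
Definition tensor U W : vectType C := 'M[C]_(dim U, dim W).

Definition tens U W (u : U) (w : W) : tensor U W := (v2r u)^T *m v2r w.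

Definition coord_vec U (i : 'I_(dim U)) : U := r2v (delta_mx 0 i).

Lemma tens_mxE U W (u : U) (w : W) i j : tens u w i j = v2r u 0 i * v2r w 0 j.
Proof. by rewrite !mxE big_ord1 !mxE. Qed.

Lemma coord_vecE U (u : U) : u = \sum_i v2r u 0 i *: coord_vec i.
Proof.
apply: v2r_inj; rewrite linear_sum /= [LHS]row_sum_delta.
by apply: eq_bigr => i _; rewrite linearZ /= r2vK.
Qed.

Lemma tensDl U W (u u' : U) (w : W) : tens (u + u') w = tens u w + tens u' w.
Proof. by rewrite /tens !linearD /= mulmxDl. Qed.
Lemma tensDr U W (u : U) (w w' : W) : tens u (w + w') = tens u w + tens u w'.
Proof. by rewrite /tens !linearD. Qed.
Lemma tensZl U W a (u : U) (w : W) : tens (a *: u) w = a *: tens u w.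
Proof. by rewrite /tens !linearZ /= -scalemxAl. Qed.
Lemma tensZr U W a (u : U) (w : W) : tens u (a *: w) = a *: tens u w.
Proof. by rewrite /tens linearZ /= -scalemxAr. Qed.
Lemma tens0l U W (w : W) : tens (0 : U) w = 0.
Proof. by rewrite -(scale0r 0) tensZl scale0r. Qed.
Lemma tens0r U W (u : U) : tens u (0 : W) = 0.
Proof. by rewrite -(scale0r 0) tensZr scale0r. Qed.
Lemma tens_suml U W (I : finType) (u : I -> U) (w : W) :
  tens (\sum_i u i) w = \sum_i tens (u i) w.
Proof. by apply: (big_morph (fun x => tens x w)) => [x y|]; rewrite ?tens0l ?tensDl. Qed.
Lemma tens_sumr U W (I : finType) (u : U) (w : I -> W) :
  tens u (\sum_i w i) = \sum_i tens u (w i).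
Proof. by apply: (big_morph (tens u)) => [x y|]; rewrite ?tens0r ?tensDr. Qed.

Definition tens_lift_fun U W X (f : U -> W -> X) (t : tensor U W) : X :=
  \sum_i \sum_j t i j *: f (coord_vec i) (coord_vec j).

Lemma tens_lift_fun_linear U W X (f : U -> W -> X) : linear (tens_lift_fun f).
Proof.
move=> a s t; rewrite /tens_lift_fun scaler_sumr -big_split; apply: eq_bigr => i _ /=.
rewrite scaler_sumr -big_split; apply: eq_bigr => j _ /=.
by rewrite !mxE scalerDl scalerA.
Qed.

HB.instance Definition _ U W X (f : U -> W -> X) :=
  GRing.isLinear.Build C (tensor U W) X _ (tens_lift_fun f) (tens_lift_fun_linear f).

Definition tens_lift U W X (f : U -> W -> X) : 'Hom(tensor U W, X) :=
  linfun (tens_lift_fun f).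

Definition bilin U W X (f : U -> W -> X) :=
  (forall w, linear (f^~ w)) /\ (forall u, linear (f u)).

Lemma linear_sumf U W (f : U -> W) (I : finType) (c : I -> C) (u : I -> U) :
  linear f -> f (\sum_i c i *: u i) = \sum_i c i *: f (u i).
Proof.
move=> fL.
have f0 : f 0 = 0.
  by apply: (@addrI _ (f 0)); rewrite -{1}[f 0]scale1r -fL scale1r !addr0.
have fD x y : f (x + y) = f x + f y by rewrite -[in LHS](scale1r x) fL scale1r.
have fZ a x : f (a *: x) = a *: f x by rewrite -[in LHS](addr0 (a *: x)) fL f0 addr0.
by rewrite (big_morph f fD f0); apply: eq_bigr => i _; rewrite fZ.
Qed.

Lemma tens_liftE U W X (f : U -> W -> X) u w :
  bilin f -> tens_lift f (tens u w) = f u w.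
Proof.
case=> fl fr; rewrite lfunE /= /tens_lift_fun.
rewrite [in RHS](coord_vecE u) (linear_sumf _ _ (fl w)); apply: eq_bigr => i _.
rewrite [in RHS](coord_vecE w) (linear_sumf _ _ (fr _)) scaler_sumr.
by apply: eq_bigr => j _; rewrite tens_mxE scalerA.
Qed.

Lemma tens_decomp U W (t : tensor U W) :
  t = \sum_i \sum_j t i j *: tens (coord_vec i) (coord_vec j).
Proof.
rewrite [LHS]matrix_sum_delta; apply: eq_bigr => i _; apply: eq_bigr => j _.
congr (_ *: _); apply/matrixP => k l; rewrite tens_mxE !r2vK !mxE eqxx /=.
by rewrite -natrM mulnb.
Qed.

Lemma tens_ext U W X (f g : 'Hom(tensor U W, X)) :
  (forall u w, f (tens u w) = g (tens u w)) -> f = g.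
Proof.
move=> E; apply/lfunP => t; rewrite (tens_decomp t).
rewrite !linear_sum; apply: eq_bigr => i _; rewrite !linear_sum.
by apply: eq_bigr => j _; rewrite !linearZ /= E.
Qed.

Lemma lfun_bilin U W X (Y : vectType C) (h : 'Hom(X, Y)) (f : U -> W -> X) :
  bilin f -> bilin (fun u w => h (f u w)).
Proof.
by case=> fl fr; split=> x a y z; rewrite ?fl ?fr linearP.
Qed.

Lemma tens_bilin U W (U' W' : vectType C) (f : 'Hom(U, U')) (g : 'Hom(W, W')) :
  bilin (fun u w => tens (f u) (g w)).
Proof.
by split=> x a y z; rewrite linearP ?tensDl ?tensZl ?tensDr ?tensZr.
Qed.

Definition tens_map U W (U' W' : vectType C) (f : 'Hom(U, U')) (g : 'Hom(W, W')) :
    'Hom(tensor U W, tensor U' W') :=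
  tens_lift (fun u w => tens (f u) (g w)).

Lemma tens_mapE U W (U' W' : vectType C) (f : 'Hom(U, U')) (g : 'Hom(W, W')) u w :
  tens_map f g (tens u w) = tens (f u) (g w).
Proof. exact: tens_liftE (tens_bilin f g). Qed.

Definition tens_assoc U W X : 'Hom(tensor (tensor U W) X, tensor U (tensor W X)) :=
  tens_lift (fun t x => tens_lift (fun u w => tens u (tens w x)) t).

Lemma tens_assocE U W X (u : U) (w : W) (x : X) :
  tens_assoc U W X (tens (tens u w) x) = tens u (tens w x).
Proof.
have B y : bilin (fun (u : U) (w : W) => tens u (tens w (y : X))).
  by split=> ? a ? ?; rewrite !(tensDl, tensZl, tensDr, tensZr).
rewrite tens_liftE ?tens_liftE //; split=> [y a s t|t a y z]; first exact: linearP.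
rewrite !lfunE /= /tens_lift_fun scaler_sumr -big_split; apply: eq_bigr => i _ /=.
rewrite scaler_sumr -big_split; apply: eq_bigr => j _ /=.
rewrite !(tensDr, tensZr) scalerDr !scalerA; congr (_ *: _ + _); exact: mulrC.
Qed.

Lemma tens3_ext U W X (Y : vectType C) (f g : 'Hom(tensor (tensor U W) X, Y)) :
  (forall u w x, f (tens (tens u w) x) = g (tens (tens u w) x)) -> f = g.
Proof.
move=> E; apply: tens_ext => t x.
rewrite (tens_decomp t) tens_suml !linear_sum; apply: eq_bigr => i _.
rewrite tens_suml !linear_sum; apply: eq_bigr => j _.
by rewrite tensZl !linearZ /= E.
Qed.
End Tensor.

Section Rep.
Variables (C : fieldType) (G : groupType).

Record rep : Type := Rep {
  rep_space :> vectType C;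
  rep_act : G -> 'End(rep_space);
  rep_act1 : forall x, rep_act 1%g x = x;
  rep_actM : forall g h x, rep_act (g * h)%g x = rep_act g (rep_act h x) }.

Implicit Types U W X Y : rep.

Record rep_hom U W : Type := RepHom {
  hom_lfun :> 'Hom(U, W);
  hom_act : forall g x, hom_lfun (rep_act U g x) = rep_act W g (hom_lfun x) }.

Lemma rep_hom_inj U W (f g : rep_hom U W) : hom_lfun f = hom_lfun g -> f = g.
Proof.
case: f g => [f fP] [g gP] /= E; subst g; congr RepHom; exact: Prop_irrelevance.
Qed.

Lemma rep_id_subproof U g x :
  (\1%VF : 'End(U)) (rep_act U g x) = rep_act U g ((\1%VF : 'End(U)) x).
Proof. by rewrite !id_lfunE. Qed.
Definition rep_id U : rep_hom U U := RepHom (@rep_id_subproof U).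

Lemma rep_comp_subproof U W X (f : rep_hom W X) (h : rep_hom U W) g x :
  (f \o h)%VF (rep_act U g x) = rep_act X g ((f \o h)%VF x).
Proof. by rewrite !comp_lfunE !hom_act. Qed.
Definition rep_comp U W X (f : rep_hom W X) (h : rep_hom U W) : rep_hom U X :=
  RepHom (rep_comp_subproof f h).

Lemma rep_tens_act1 U W x :
  tens_map (rep_act U 1%g) (rep_act W 1%g) x = x.
Proof.
rewrite -[RHS]id_lfunE; congr (fun_of_lfun _ _); apply: tens_ext => u w.
by rewrite tens_mapE !rep_act1 id_lfunE.
Qed.
Lemma rep_tens_actM U W g h x :
  tens_map (rep_act U (g * h)%g) (rep_act W (g * h)%g) x =
  tens_map (rep_act U g) (rep_act W g) (tens_map (rep_act U h) (rep_act W h) x).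
Proof.
rewrite -[RHS]comp_lfunE; congr (fun_of_lfun _ _); apply: tens_ext => u w.
by rewrite comp_lfunE !tens_mapE !rep_actM.
Qed.
Definition rep_tens U W : rep :=
  @Rep (tensor U W) (fun g => tens_map (rep_act U g) (rep_act W g))
    (@rep_tens_act1 U W) (@rep_tens_actM U W).

Lemma hom_tens_subproof U W U' W' (f : rep_hom U U') (h : rep_hom W W') g x :
  tens_map f h (rep_act (rep_tens U W) g x) =
  rep_act (rep_tens U' W') g (tens_map f h x).
Proof.
rewrite -!comp_lfunE; congr (fun_of_lfun _ _); apply: tens_ext => u w.
by rewrite !comp_lfunE /= !tens_mapE !hom_act.
Qed.
Definition hom_tens U W U' W' (f : rep_hom U U') (h : rep_hom W W') :
    rep_hom (rep_tens U W) (rep_tens U' W') :=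
  @RepHom (rep_tens U W) (rep_tens U' W') (tens_map f h) (hom_tens_subproof f h).

Definition rep_unit : rep :=
  @Rep C^o (fun=> \1%VF) (@id_lfunE _ _) (fun _ _ x => esym (id_lfunE (\1%VF x))).

Lemma rep_assoc_subproof U W X g x :
  tens_assoc U W X (rep_act (rep_tens (rep_tens U W) X) g x) =
  rep_act (rep_tens U (rep_tens W X)) g (tens_assoc U W X x).
Proof.
rewrite -!comp_lfunE; congr (fun_of_lfun _ _); apply: tens3_ext => u w y.
by rewrite !comp_lfunE /= !(tens_mapE, tens_assocE).
Qed.
Definition rep_assoc U W X :
    rep_hom (rep_tens (rep_tens U W) X) (rep_tens U (rep_tens W X)) :=
  @RepHom (rep_tens (rep_tens U W) X) (rep_tens U (rep_tens W X))
    (tens_assoc U W X) (@rep_assoc_subproof U W X).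

Definition tens_lunit (U : vectType C) : 'Hom(tensor C^o U, U) :=
  tens_lift (fun (c : C^o) u => c *: u).
Definition tens_runit (U : vectType C) : 'Hom(tensor U C^o, U) :=
  tens_lift (fun u (c : C^o) => c *: u).

Lemma tens_lunitE (U : vectType C) (c : C^o) (u : U) : tens_lunit U (tens c u) = c *: u.
Proof.
apply: tens_liftE; split=> [v a x y|x a y z]; first by rewrite scalerDl scalerA.
by rewrite scalerDr !scalerA [x * a]mulrC.
Qed.
Lemma tens_runitE (U : vectType C) (c : C^o) (u : U) : tens_runit U (tens u c) = c *: u.
Proof.
apply: (@tens_liftE _ _ _ _ (fun u (c : C^o) => c *: u)).
split=> [v a x y|x a y z]; last by rewrite scalerDl scalerA.
by rewrite scalerDr !scalerA [v * a]mulrC.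
Qed.

Lemma rep_lunit_subproof U g x :
  tens_lunit U (rep_act (rep_tens rep_unit U) g x) = rep_act U g (tens_lunit U x).
Proof.
rewrite -!comp_lfunE; congr (fun_of_lfun _ _); apply: tens_ext => c u.
by rewrite !comp_lfunE /= tens_mapE !tens_lunitE id_lfunE linearZ.
Qed.
Definition rep_lunit U : rep_hom (rep_tens rep_unit U) U :=
  @RepHom (rep_tens rep_unit U) U (tens_lunit U) (@rep_lunit_subproof U).

Lemma rep_runit_subproof U g x :
  tens_runit U (rep_act (rep_tens U rep_unit) g x) = rep_act U g (tens_runit U x).
Proof.
rewrite -!comp_lfunE; congr (fun_of_lfun _ _); apply: tens_ext => u c.
by rewrite !comp_lfunE /= tens_mapE !tens_runitE id_lfunE linearZ.
Qed.
Definition rep_runit U : rep_hom (rep_tens U rep_unit) U :=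
  @RepHom (rep_tens U rep_unit) U (tens_runit U) (@rep_runit_subproof U).

Record alg_obj : Type := AlgObj {
  alg_rep :> rep;
  alg_mul : rep_hom (rep_tens alg_rep alg_rep) alg_rep;
  alg_one : rep_hom rep_unit alg_rep;
  alg_mulA :
    rep_comp alg_mul (hom_tens alg_mul (rep_id alg_rep)) =
    rep_comp alg_mul (rep_comp (hom_tens (rep_id alg_rep) alg_mul)
                               (rep_assoc alg_rep alg_rep alg_rep));
  alg_mul1l : rep_comp alg_mul (hom_tens alg_one (rep_id alg_rep)) = rep_lunit alg_rep;
  alg_mul1r : rep_comp alg_mul (hom_tens (rep_id alg_rep) alg_one) = rep_runit alg_rep }.

Record alg_iso (X Y : alg_obj) : Type := AlgIso {
  iso_hom :> rep_hom X Y;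
  iso_inv : rep_hom Y X;
  iso_homK : rep_comp iso_inv iso_hom = rep_id X;
  iso_invK : rep_comp iso_hom iso_inv = rep_id Y;
  iso_mul : rep_comp iso_hom (alg_mul X) =
            rep_comp (alg_mul Y) (hom_tens iso_hom iso_hom);
  iso_one : rep_comp iso_hom (alg_one X) = alg_one Y }.

End Rep.

Section Weights.
Variables (C : numClosedFieldType) (A : finZmodType).
Local Notation V := (VA C A).
Variable U : rep C (asp C A).
Implicit Types (u v w : V) (chi : dual C V) (T S : sympl C A).

Definition rho T : 'End(U) := rep_act U (Asp T 0).
Definition act_char chi : 'End(U) := rep_act U (Asp 1%g chi).

Definition weight v : {vspace U} :=
  (\bigcap_(chi : dual C V) lker (act_char chi - chi v *: \1%VF))%VS.

Lemma weightP v x :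
  reflect (forall chi, act_char chi x = chi v *: x) (x \in weight v).
Proof.
have E chi : (x \in lker (act_char chi - chi v *: \1%VF)) = (act_char chi x == chi v *: x).
  by rewrite memv_ker add_lfunE opp_lfunE scale_lfunE id_lfunE subr_eq0.
rewrite /weight memvE; apply: (iffP subv_bigcapP) => H chi.
  by apply/eqP; rewrite -E memvE H.
by move=> _; rewrite -memvE E H.
Qed.

Lemma act_charD chi psi x : act_char (chi + psi) x = act_char chi (act_char psi x).
Proof.
rewrite -rep_actM; congr (rep_act U _ x); apply: asp_eqP; first by rewrite /= mulg1.
by move=> v; rewrite asp_chi_mul sympl1E dualDE.
Qed.

Lemma act_char0 x : act_char 0 x = x.
Proof. exact: rep_act1. Qed.

Lemma act_char_rho chi T x : act_char chi (rho T x) = rho T (act_char (dual_pull chi T) x).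
Proof.
rewrite -!rep_actM; congr (rep_act U _ x); apply: asp_eqP => [|v].
  by rewrite /= mul1g mulg1.
by rewrite !asp_chi_mul dual_pullE !dual0E mulr1 mul1r.
Qed.

Lemma rho1 x : rho 1%g x = x.
Proof. exact: rep_act1. Qed.

Lemma rhoM T S x : rho (T * S)%g x = rho T (rho S x).
Proof.
rewrite -rep_actM; congr (rep_act U _ x); apply: asp_eqP => // v.
by rewrite asp_chi_mul !dual0E mulr1.
Qed.

Lemma rep_act_asp T chi x : rep_act U (Asp T chi) x = rho T (act_char chi x).
Proof.
rewrite -rep_actM; congr (rep_act U _ x); apply: asp_eqP => [|v].
  by rewrite /= mulg1.
by rewrite asp_chi_mul sympl1E dual0E mul1r.
Qed.

Lemma rho_weight T v x : x \in weight v -> rho T x \in weight (T v).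
Proof.
move=> /weightP H; apply/weightP => chi.
by rewrite act_char_rho H linearZ dual_pullE.
Qed.

Let fourier v : 'End(U) :=
  #|{: V}|%:R^-1 *: \sum_(chi : dual C V) chi (- v) *: act_char chi.

Let cardV0 : #|{: V}|%:R != 0 :> C.
Proof. by rewrite pnatr_eq0 -lt0n; apply/card_gt0P; exists 0. Qed.

Let fourierE v x :
  fourier v x = #|{: V}|%:R^-1 *: \sum_(chi : dual C V) chi (- v) *: act_char chi x.
Proof.
rewrite /fourier lfunE /= sum_lfunE; congr (_ *: _); apply: eq_bigr => chi _.
by rewrite lfunE.
Qed.

Let fourier_weight v x : fourier v x \in weight v.
Proof.
apply/weightP => psi; rewrite fourierE linearZ /= [RHS]scalerA [_ * _^-1]mulrC -scalerA.
congr (_ *: _); rewrite linear_sum scaler_sumr [RHS](reindex_inj (addrI psi)) /=.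
apply: eq_bigr => chi _; rewrite linearZ /= act_charD scalerA; congr (_ *: _).
by rewrite dualDE mulrA !charN mulfV ?mul1r // char_neq0.
Qed.

Let fourier_id v x : x \in weight v -> fourier v x = x.
Proof.
move=> /weightP H; rewrite fourierE.
under eq_bigr do rewrite H scalerA -charD addNr char0 scale1r.
by rewrite sumr_const card_dual -scaler_nat scalerA mulVf ?scale1r.
Qed.

Let fourier_0 v w x : w != v -> x \in weight w -> fourier v x = 0.
Proof.
move=> ne /weightP H; rewrite fourierE.
under eq_bigr do rewrite H scalerA -charD.
by rewrite -scaler_suml sum_dual addrC subr_eq0 (negPf ne) scale0r scaler0.
Qed.

Let fourier_sum x : \sum_(v : V) fourier v x = x.
Proof.
under eq_bigr do rewrite fourierE.
rewrite -scaler_sumr exchange_big /=.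
under eq_bigr => chi _.
  rewrite -scaler_suml (reindex_inj (@oppr_inj V)) /=.
  under eq_bigr do rewrite opprK.
  rewrite sum_char; over.
rewrite (bigD1 0) //= eqxx big1 ?addr0 => [|chi /negPf ->]; last by rewrite scale0r.
by rewrite act_char0 scalerA mulVf ?scale1r.
Qed.

Lemma weight_full : (\sum_(v : V) weight v)%VS = fullv.
Proof.
apply/eqP; rewrite eqEsubv subvf /=; apply/subvP => x _.
by rewrite -(fourier_sum x); apply: memv_sumr.
Qed.

Lemma weight_direct : directv (\sum_(v : V) weight v).
Proof.
apply/directv_sum_independent => us usP E v _.
have := congr1 (fourier v) E; rewrite linear_sum linear0 (bigD1 v) //=.
rewrite fourier_id ?usP // big1 ?addr0 // => w ne.
by rewrite (fourier_0 ne) // usP.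
Qed.

(* By [weight_full] and [weight_direct], U is the direct sum of its weight
   spaces U_v; this is the projection onto U_v. *)
Definition weight_comp v : 'End(U) := sumv_pi (\sum_(w : V) weight w)%VS v.

Lemma weight_comp_in v x : weight_comp v x \in weight v.
Proof. exact: memv_sum_pi. Qed.

Lemma weight_comp_sum x : \sum_v weight_comp v x = x.
Proof. by apply: sumv_pi_sum; rewrite weight_full memvf. Qed.

Lemma weight_compE v w x :
  x \in weight w -> weight_comp v x = if v == w then x else 0.
Proof.
move=> xw; rewrite -[LHS](@fourier_id v) ?weight_comp_in //.
have -> : fourier v (weight_comp v x) = fourier v x.
  rewrite -[in RHS](weight_comp_sum x) linear_sum (bigD1 v) //= big1 ?addr0 // => u ne.
  by rewrite (fourier_0 ne) // weight_comp_in.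
case: eqVneq => [->|ne]; first exact: fourier_id.
by rewrite (fourier_0 _ xw) // eq_sym.
Qed.

Lemma weight_ext (X : vectType C) (f h : 'Hom(U, X)) :
  (forall v x, x \in weight v -> f x = h x) -> f = h.
Proof.
move=> E; apply/lfunP => x; rewrite -(weight_comp_sum x) !linear_sum.
by apply: eq_bigr => v _; apply: (E v); apply: weight_comp_in.
Qed.

(* (T, lambda) acts on U_v as lambda(v) rho(T), see [F_actE]. *)
Definition F_act (g : clifford C A) : 'End(U) :=
  \sum_(v : V) cl_lambda g v *: (rho (cl_sp g) \o weight_comp v)%VF.

Lemma F_actE g v x : x \in weight v -> F_act g x = cl_lambda g v *: rho (cl_sp g) x.
Proof.
move=> xv; rewrite /F_act sum_lfunE (bigD1 v) //= big1 ?addr0 => [|w ne].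
  by rewrite lfunE /= comp_lfunE (weight_compE _ xv) eqxx.
by rewrite lfunE /= comp_lfunE (weight_compE _ xv) (negPf ne) linear0 scaler0.
Qed.

Lemma F_act1 x : F_act 1%g x = x.
Proof.
rewrite -[RHS]id_lfunE; congr (fun_of_lfun _ _); apply: weight_ext => v y yv.
by rewrite (F_actE _ yv) cl1_lambda scale1r cl_sp1 rho1 id_lfunE.
Qed.

Lemma F_actM g h x : F_act (g * h)%g x = F_act g (F_act h x).
Proof.
rewrite -[RHS]comp_lfunE; congr (fun_of_lfun _ _); apply: weight_ext => v y yv.
rewrite comp_lfunE !(F_actE _ yv) linearZ /= (F_actE _ (rho_weight _ yv)).
by rewrite clM_lambda cl_spM rhoM scalerA mulrC.
Qed.

Definition F_obj : rep C (clifford C A) := Rep F_act1 F_actM.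

End Weights.

Section Functor.
Variables (C : numClosedFieldType) (A : finZmodType).
Local Notation V := (VA C A).
Implicit Types U W X : rep C (asp C A).

Lemma hom_weight U W (f : rep_hom U W) v x : x \in weight U v -> f x \in weight W v.
Proof. by move=> /weightP H; apply/weightP => chi; rewrite -hom_act H linearZ. Qed.

Lemma F_hom_subproof U W (f : rep_hom U W) (g : clifford C A) x :
  f (F_act U g x) = F_act W g (f x).
Proof.
rewrite -!comp_lfunE; congr (fun_of_lfun _ _); apply: weight_ext => v y yv.
by rewrite !comp_lfunE (F_actE _ yv) (F_actE _ (hom_weight f yv)) linearZ /= hom_act.
Qed.

Definition F_hom U W (f : rep_hom U W) : rep_hom (F_obj U) (F_obj W) :=
  @RepHom _ _ (F_obj U) (F_obj W) f (F_hom_subproof f).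

Lemma tens_weight U W v w x y : x \in weight U v -> y \in weight W w ->
  tens x y \in weight (rep_tens U W) (v + w).
Proof.
move=> /weightP Hx /weightP Hy; apply/weightP => chi.
by rewrite /act_char /= tens_mapE Hx Hy tensZl tensZr scalerA charD.
Qed.

Lemma rho_tens U W T x y :
  rho (rep_tens U W) T (tens x y) = tens (rho U T x) (rho W T y).
Proof. exact: tens_mapE. Qed.

Lemma weight_tens_ext U W (X : vectType C) (f h : 'Hom(tensor U W, X)) :
  (forall v w x y, x \in weight U v -> y \in weight W w ->
     f (tens x y) = h (tens x y)) -> f = h.
Proof.
move=> E; apply: tens_ext => x y; rewrite -(weight_comp_sum x) -(weight_comp_sum y).
rewrite tens_suml !linear_sum; apply: eq_bigr => v _.
rewrite tens_sumr !linear_sum; apply: eq_bigr => w _.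
by apply: (E v w); apply: weight_comp_in.
Qed.

(* x (x) y |-> beta(v, w) x (x) y for x in U_v and y in W_w, see [J_lfunE]. *)
Definition J_lfun U W : 'Hom(tensor U W, tensor U W) :=
  tens_lift (fun x y => \sum_(v : V) \sum_(w : V)
    beta v w *: tens (weight_comp U v x) (weight_comp W w y)).

Lemma J_lfunE U W v w x y : x \in weight U v -> y \in weight W w ->
  J_lfun U W (tens x y) = beta v w *: tens x y.
Proof.
move=> xv yw; rewrite tens_liftE; last first.
  split=> [z a s t|z a s t] /=; rewrite scaler_sumr -big_split; apply: eq_bigr => i _ /=;
    rewrite scaler_sumr -big_split; apply: eq_bigr => j _ /=;
    by rewrite linearP ?(tensDl, tensDr) ?(tensZl, tensZr) scalerDr !scalerA [_ * a]mulrC.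
rewrite (bigD1 v) //= [X in _ + X]big1 => [|i ne]; last first.
  rewrite big1 // => j _; rewrite (weight_compE _ xv) (negPf ne) tens0l scaler0 //.
rewrite (bigD1 w) //= big1 ?addr0 => [|j ne]; last first.
  by rewrite (weight_compE _ yw) (negPf ne) tens0r scaler0.
by rewrite (weight_compE _ xv) (weight_compE _ yw) !eqxx.
Qed.

Lemma J_subproof U W (g : clifford C A) x :
  J_lfun U W (rep_act (rep_tens (F_obj U) (F_obj W)) g x) =
  rep_act (F_obj (rep_tens U W)) g (J_lfun U W x).
Proof.
rewrite -!comp_lfunE; congr (fun_of_lfun _ _); apply: weight_tens_ext => v w y z yv zw.
rewrite !comp_lfunE /= tens_mapE (J_lfunE yv zw) linearZ /=.
rewrite (F_actE _ yv) (F_actE _ zw) (F_actE _ (tens_weight yv zw)).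
rewrite tensZl tensZr !linearZ /= (J_lfunE (rho_weight _ yv) (rho_weight _ zw)).
rewrite rho_tens !scalerA; congr (_ *: _).
by rewrite cl_cocycle -[RHS]mulrA [RHS]mulrC.
Qed.

Definition J U W : rep_hom (rep_tens (F_obj U) (F_obj W)) (F_obj (rep_tens U W)) :=
  @RepHom _ _ (rep_tens (F_obj U) (F_obj W)) (F_obj (rep_tens U W))
    (J_lfun U W) (@J_subproof U W).

Lemma JE U W v w (x : U) (y : W) : x \in weight U v -> y \in weight W w ->
  J U W (tens (x : F_obj U) (y : F_obj W)) = beta v w *: tens x y.
Proof. exact: J_lfunE. Qed.

(* The unit constraint of F is the identity of C. *)
Lemma J0_subproof (g : clifford C A) (x : rep_unit C (clifford C A)) :
  (\1%VF : 'End(C^o)) (rep_act (rep_unit C (clifford C A)) g x) =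
  rep_act (F_obj (rep_unit C (asp C A))) g ((\1%VF : 'End(C^o)) x).
Proof.
rewrite !id_lfunE /=.
have x0 : x \in weight (rep_unit C (asp C A)) 0.
  by apply/weightP => chi; rewrite /act_char /= id_lfunE char0 scale1r.
by rewrite (F_actE _ x0) cl_lambda0 scale1r /rho /= id_lfunE.
Qed.

Definition J0 : rep_hom (rep_unit C (clifford C A)) (F_obj (rep_unit C (asp C A))) :=
  @RepHom _ _ (rep_unit C (clifford C A)) (F_obj (rep_unit C (asp C A)))
    \1%VF J0_subproof.

Lemma J_nat U W (U' W' : rep C (asp C A)) (f : rep_hom U U') (h : rep_hom W W') :
  rep_comp (F_hom (hom_tens f h)) (J U W) =
  rep_comp (J U' W') (hom_tens (F_hom f) (F_hom h)).
Proof.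
apply: rep_hom_inj; apply: weight_tens_ext => v w x y xv yw /=.
rewrite !comp_lfunE (J_lfunE xv yw) linearZ /= !tens_mapE.
by rewrite (J_lfunE (hom_weight f xv) (hom_weight h yw)).
Qed.

Lemma weight_tens3_ext U W X (Y : vectType C)
    (f h : 'Hom(tensor (tensor U W) X, Y)) :
  (forall u v w x y z, x \in weight U u -> y \in weight W v -> z \in weight X w ->
     f (tens (tens x y) z) = h (tens (tens x y) z)) -> f = h.
Proof.
move=> E; apply: tens3_ext => x y z.
rewrite -(weight_comp_sum x) -(weight_comp_sum y) -(weight_comp_sum z).
rewrite !tens_suml !linear_sum; apply: eq_bigr => u _.
rewrite tens_sumr !linear_sum; apply: eq_bigr => w _.
rewrite tens_sumr tens_suml !linear_sum; apply: eq_bigr => v _.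
by apply: (E u v w); apply: weight_comp_in.
Qed.

Lemma J_assoc U W X :
  rep_comp (F_hom (rep_assoc U W X))
    (rep_comp (J (rep_tens U W) X) (hom_tens (J U W) (rep_id (F_obj X)))) =
  rep_comp (J U (rep_tens W X))
    (rep_comp (hom_tens (rep_id (F_obj U)) (J W X))
              (rep_assoc (F_obj U) (F_obj W) (F_obj X))).
Proof.
apply: rep_hom_inj; apply: weight_tens3_ext => u v w x y z xu yv zw /=.
rewrite !comp_lfunE tens_assocE !tens_mapE !id_lfunE (J_lfunE xu yv) (J_lfunE yv zw).
rewrite tensZl tensZr !linearZ /= (J_lfunE (tens_weight xu yv) zw).
rewrite (J_lfunE xu (tens_weight yv zw)) !linearZ /= tens_assocE !scalerA.
by rewrite betaDl betaDr; congr (_ *: _); rewrite mulrC mulrA.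
Qed.

Lemma weight0_unit (c : rep_unit C (asp C A)) : c \in weight (rep_unit C (asp C A)) 0.
Proof. by apply/weightP => chi; rewrite /act_char /= id_lfunE char0 scale1r. Qed.

Lemma J_lunit U :
  rep_comp (F_hom (rep_lunit U))
    (rep_comp (J (rep_unit C (asp C A)) U) (hom_tens J0 (rep_id (F_obj U)))) =
  rep_lunit (F_obj U).
Proof.
apply: rep_hom_inj; apply: tens_ext => c x; rewrite -(weight_comp_sum x).
rewrite tens_sumr !linear_sum; apply: eq_bigr => v _ /=.
rewrite !comp_lfunE tens_mapE !id_lfunE.
by rewrite (J_lfunE (weight0_unit c) (weight_comp_in _ _)) beta0l scale1r.
Qed.

Lemma J_runit U :
  rep_comp (F_hom (rep_runit U))
    (rep_comp (J U (rep_unit C (asp C A))) (hom_tens (rep_id (F_obj U)) J0)) =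
  rep_runit (F_obj U).
Proof.
apply: rep_hom_inj; apply: tens_ext => x c; rewrite -(weight_comp_sum x).
rewrite tens_suml !linear_sum; apply: eq_bigr => v _ /=.
rewrite !comp_lfunE tens_mapE !id_lfunE.
by rewrite (J_lfunE (weight_comp_in _ _) (weight0_unit c)) beta0r scale1r.
Qed.

Section Algebra.
Variable X : alg_obj C (asp C A).

Definition F_mul : rep_hom (rep_tens (F_obj X) (F_obj X)) (F_obj X) :=
  rep_comp (F_hom (alg_mul X)) (J X X).
Definition F_one : rep_hom (rep_unit C (clifford C A)) (F_obj X) :=
  rep_comp (F_hom (alg_one X)) J0.

Lemma rep_compA (G : groupType) (Y1 Y2 Y3 Y4 : rep C G) (f : rep_hom Y3 Y4)
    (g : rep_hom Y2 Y3) (h : rep_hom Y1 Y2) :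
  rep_comp f (rep_comp g h) = rep_comp (rep_comp f g) h.
Proof. by apply/rep_hom_inj/lfunP => x; rewrite /= !comp_lfunE. Qed.

Lemma F_hom_comp (Y1 Y2 Y3 : rep C (asp C A)) (f : rep_hom Y2 Y3) (g : rep_hom Y1 Y2) :
  F_hom (rep_comp f g) = rep_comp (F_hom f) (F_hom g).
Proof. exact: rep_hom_inj. Qed.

Lemma F_hom_id (Y : rep C (asp C A)) : F_hom (rep_id Y) = rep_id (F_obj Y).
Proof. exact: rep_hom_inj. Qed.

Lemma hom_tens_comp (G : groupType) (Y1 Y2 Y3 Z1 Z2 Z3 : rep C G) (f : rep_hom Y2 Y3)
    (g : rep_hom Y1 Y2) (f' : rep_hom Z2 Z3) (g' : rep_hom Z1 Z2) :
  hom_tens (rep_comp f g) (rep_comp f' g') = rep_comp (hom_tens f f') (hom_tens g g').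
Proof.
apply: rep_hom_inj; apply: tens_ext => x y /=.
by rewrite comp_lfunE !tens_mapE !comp_lfunE.
Qed.

Lemma rep_comp_id (G : groupType) (Y Z : rep C G) (f : rep_hom Y Z) :
  rep_comp f (rep_id Y) = f.
Proof. by apply/rep_hom_inj/lfunP => x; rewrite /= comp_lfunE id_lfunE. Qed.

Lemma F_mulA :
  rep_comp F_mul (hom_tens F_mul (rep_id (F_obj X))) =
  rep_comp F_mul (rep_comp (hom_tens (rep_id (F_obj X)) F_mul)
                           (rep_assoc (F_obj X) (F_obj X) (F_obj X))).
Proof.
rewrite /F_mul -{1}(rep_comp_id (rep_id (F_obj X))) -{3}(rep_comp_id (rep_id (F_obj X))).
rewrite !hom_tens_comp -!F_hom_id -!rep_compA.
rewrite [rep_comp (J X X) (rep_comp _ _)]rep_compA -J_nat.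
rewrite [in RHS](rep_compA (J X X)) -J_nat -!rep_compA.
rewrite F_hom_id -J_assoc !rep_compA -!F_hom_comp.
by rewrite alg_mulA -!rep_compA.
Qed.

Lemma F_mul1l : rep_comp F_mul (hom_tens F_one (rep_id (F_obj X))) = rep_lunit (F_obj X).
Proof.
rewrite /F_mul /F_one -{1}(rep_comp_id (rep_id (F_obj X))) hom_tens_comp.
rewrite -{1}F_hom_id -!rep_compA (rep_compA (J X X)) -J_nat -!rep_compA.
by rewrite (rep_compA (F_hom (alg_mul X))) -F_hom_comp alg_mul1l J_lunit.
Qed.

Lemma F_mul1r : rep_comp F_mul (hom_tens (rep_id (F_obj X)) F_one) = rep_runit (F_obj X).
Proof.
rewrite /F_mul /F_one -{1}(rep_comp_id (rep_id (F_obj X))) hom_tens_comp.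
rewrite -{1}F_hom_id -!rep_compA (rep_compA (J X X)) -J_nat -!rep_compA.
by rewrite (rep_compA (F_hom (alg_mul X))) -F_hom_comp alg_mul1r J_runit.
Qed.

Definition F_alg : alg_obj C (clifford C A) := AlgObj F_mulA F_mul1l F_mul1r.

End Algebra.
End Functor.

Section FreeSpace.
Variables (C : fieldType) (V : finType).

Definition free_space : vectType C := {ffun V -> C^o}.

Definition basis_vec (v : V) : free_space := [ffun w => (w == v)%:R : C^o].

Lemma free_spaceE (f : free_space) : f = \sum_v (f : {ffun V -> C^o}) v *: basis_vec v.
Proof.
apply/ffunP => w; rewrite sum_ffunE (bigD1 w) //= big1 ?addr0 => [|v ne].
  by rewrite !ffunE eqxx /GRing.scale /= mulr1.
by rewrite !ffunE eq_sym (negPf ne) scaler0.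
Qed.

Definition basis_ext_fun (X : vectType C) (h : V -> X) (f : free_space) : X :=
  \sum_v ((f : {ffun V -> C^o}) v : C) *: h v.

Lemma basis_ext_fun_linear (X : vectType C) (h : V -> X) : linear (basis_ext_fun h).
Proof.
move=> a f g; rewrite /basis_ext_fun scaler_sumr -big_split; apply: eq_bigr => v _ /=.
by rewrite !ffunE scalerDl scalerA.
Qed.

HB.instance Definition _ (X : vectType C) (h : V -> X) :=
  GRing.isLinear.Build C free_space X _ (basis_ext_fun h) (basis_ext_fun_linear h).

Definition basis_ext (X : vectType C) (h : V -> X) : 'Hom(free_space, X) :=
  linfun (basis_ext_fun h).

Lemma basis_extE (X : vectType C) (h : V -> X) v : basis_ext h (basis_vec v) = h v.
Proof.
rewrite lfunE /= /basis_ext_fun (bigD1 v) //= big1 ?addr0 => [|w ne].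
  by rewrite ffunE eqxx scale1r.
by rewrite ffunE (negPf ne) scale0r.
Qed.

Lemma basis_eq (X : vectType C) (f g : 'Hom(free_space, X)) :
  (forall v, f (basis_vec v) = g (basis_vec v)) -> f = g.
Proof.
move=> E; apply/lfunP => x; rewrite (free_spaceE x) !linear_sum.
by apply: eq_bigr => v _; rewrite !linearZ /= E.
Qed.

Definition basis_ext2 (X : vectType C) (h : V -> V -> X) :
    'Hom(tensor free_space free_space, X) :=
  tens_lift (fun f g => basis_ext (fun v => basis_ext (h v) g) f).

Lemma basis_ext2E (X : vectType C) (h : V -> V -> X) v w :
  basis_ext2 h (tens (basis_vec v) (basis_vec w)) = h v w.
Proof.
rewrite /basis_ext2 tens_liftE ?basis_extE //; split=> [g a x y|f a x y].
  exact: linearP.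
rewrite !lfunE /= /basis_ext_fun scaler_sumr -big_split; apply: eq_bigr => u _ /=.
by rewrite linearP scalerDr !scalerA mulrC.
Qed.

Lemma basis_eq2 (X : vectType C) (f g : 'Hom(tensor free_space free_space, X)) :
  (forall v w, f (tens (basis_vec v) (basis_vec w)) =
               g (tens (basis_vec v) (basis_vec w))) -> f = g.
Proof.
move=> E; apply: tens_ext => x y; rewrite (free_spaceE x) (free_spaceE y).
rewrite !tens_suml !linear_sum; apply: eq_bigr => v _.
rewrite tens_sumr !linear_sum; apply: eq_bigr => w _.
by rewrite tensZl tensZr !linearZ /= E.
Qed.

Lemma basis_eq3 (X : vectType C)
    (f g : 'Hom(tensor (tensor free_space free_space) free_space, X)) :
  (forall u v w, f (tens (tens (basis_vec u) (basis_vec v)) (basis_vec w)) =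
                 g (tens (tens (basis_vec u) (basis_vec v)) (basis_vec w))) -> f = g.
Proof.
move=> E; apply: tens3_ext => x y z.
rewrite (free_spaceE x) (free_spaceE y) (free_spaceE z).
rewrite !tens_suml !linear_sum; apply: eq_bigr => u _.
rewrite tens_sumr !linear_sum; apply: eq_bigr => w _.
rewrite tens_sumr tens_suml !linear_sum; apply: eq_bigr => v _.
by rewrite !(tensZl, tensZr) !linearZ /= E.
Qed.

Definition unit_ext_fun (X : vectType C) (x : X) (c : C^o) : X := c *: x.

Lemma unit_ext_fun_linear (X : vectType C) (x : X) : linear (unit_ext_fun x).
Proof. by move=> a c d; rewrite /unit_ext_fun scalerDl scalerA. Qed.

HB.instance Definition _ (X : vectType C) (x : X) :=
  GRing.isLinear.Build C C^o X _ (unit_ext_fun x) (unit_ext_fun_linear x).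

Definition unit_ext (X : vectType C) (x : X) : 'Hom(C^o, X) := linfun (unit_ext_fun x).

Lemma unit_extE (X : vectType C) (x : X) c : unit_ext x c = c *: x.
Proof. by rewrite lfunE. Qed.

End FreeSpace.

Section Algebras.
Variables (C : numClosedFieldType) (A : finZmodType).
Local Notation V := (VA C A).
Local Notation CV := (free_space C V).

Definition delta (v : V) : CV := basis_vec C v.

Definition ga_act (g : asp C A) : 'End(CV) :=
  basis_ext (fun v => asp_chi g v *: delta (asp_T g v)).

Lemma ga_actE g v : ga_act g (delta v) = asp_chi g v *: delta (asp_T g v).
Proof. exact: basis_extE. Qed.

Lemma ga_act1 x : ga_act 1%g x = x.
Proof.
rewrite -[RHS]id_lfunE; congr (fun_of_lfun _ _); apply: basis_eq => v.
by rewrite ga_actE asp_chi_one scale1r sympl1E id_lfunE.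
Qed.

Lemma ga_actM g h x : ga_act (g * h)%g x = ga_act g (ga_act h x).
Proof.
rewrite -[RHS]comp_lfunE; congr (fun_of_lfun _ _); apply: basis_eq => v.
rewrite comp_lfunE; apply: etrans (ga_actE _ _) _.
apply/esym/(etrans (congr1 (ga_act g) (ga_actE h v))); rewrite linearZ.
apply: etrans (congr1 ( *:%R (asp_chi h v)) (ga_actE g _)) _.
by rewrite asp_chi_mul scalerA mulrC symplME.
Qed.

Definition ga_rep : rep C (asp C A) := Rep ga_act1 ga_actM.

Definition ga_mul_lfun : 'Hom(tensor CV CV, CV) := basis_ext2 (fun v w => delta (v + w)).

Lemma ga_mul_lfunE v w : ga_mul_lfun (tens (delta v) (delta w)) = delta (v + w).
Proof. exact: basis_ext2E. Qed.

Lemma ga_mul_subproof g x :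
  ga_mul_lfun (rep_act (rep_tens ga_rep ga_rep) g x) = rep_act ga_rep g (ga_mul_lfun x).
Proof.
rewrite -!comp_lfunE; congr (fun_of_lfun _ _); apply: basis_eq2 => v w.
rewrite !comp_lfunE /= tens_mapE ga_mul_lfunE !ga_actE tensZl tensZr !linearZ /=.
by rewrite ga_mul_lfunE scalerA charD zautD.
Qed.

Definition ga_mul : rep_hom (rep_tens ga_rep ga_rep) ga_rep :=
  @RepHom _ _ (rep_tens ga_rep ga_rep) ga_rep ga_mul_lfun ga_mul_subproof.

Definition ga_one_lfun : 'Hom(C^o, CV) := unit_ext (delta 0).

Lemma ga_one_lfunE (c : C^o) : ga_one_lfun c = c *: delta 0.
Proof. exact: unit_extE. Qed.

Lemma ga_one_subproof g x :
  ga_one_lfun (rep_act (rep_unit C (asp C A)) g x) = rep_act ga_rep g (ga_one_lfun x).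
Proof.
by rewrite /= id_lfunE ga_one_lfunE linearZ /= ga_actE char0 zaut0 scale1r.
Qed.

Definition ga_one : rep_hom (rep_unit C (asp C A)) ga_rep :=
  @RepHom _ _ (rep_unit C (asp C A)) ga_rep ga_one_lfun ga_one_subproof.

Lemma ga_mulA :
  rep_comp ga_mul (hom_tens ga_mul (rep_id ga_rep)) =
  rep_comp ga_mul (rep_comp (hom_tens (rep_id ga_rep) ga_mul)
                            (rep_assoc ga_rep ga_rep ga_rep)).
Proof.
apply: rep_hom_inj; apply: basis_eq3 => u v w /=.
by rewrite !comp_lfunE tens_assocE !tens_mapE !id_lfunE !ga_mul_lfunE addrA.
Qed.

Lemma ga_mul1l : rep_comp ga_mul (hom_tens ga_one (rep_id ga_rep)) = rep_lunit ga_rep.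
Proof.
apply: rep_hom_inj; apply: tens_ext => c x /=.
rewrite comp_lfunE tens_mapE id_lfunE tens_lunitE ga_one_lfunE tensZl linearZ /=.
congr (_ *: _); rewrite [x in LHS](free_spaceE x) tens_sumr linear_sum.
rewrite [RHS](free_spaceE x); apply: eq_bigr => v _.
by rewrite tensZr linearZ /= ga_mul_lfunE add0r.
Qed.

Lemma ga_mul1r : rep_comp ga_mul (hom_tens (rep_id ga_rep) ga_one) = rep_runit ga_rep.
Proof.
apply: rep_hom_inj; apply: tens_ext => x c /=.
rewrite comp_lfunE tens_mapE id_lfunE tens_runitE ga_one_lfunE tensZr linearZ /=.
congr (_ *: _); rewrite [x in LHS](free_spaceE x) tens_suml linear_sum.
rewrite [RHS](free_spaceE x); apply: eq_bigr => v _.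
by rewrite tensZl linearZ /= ga_mul_lfunE addr0.
Qed.

Definition group_algebra : alg_obj C (asp C A) := AlgObj ga_mulA ga_mul1l ga_mul1r.

Definition tw (v : V) : CV := basis_vec C v.

Definition ta_act (g : clifford C A) : 'End(CV) :=
  basis_ext (fun v => cl_lambda g v *: tw (cl_T g v)).

Lemma ta_actE g v : ta_act g (tw v) = cl_lambda g v *: tw (cl_T g v).
Proof. exact: basis_extE. Qed.

Lemma ta_act1 x : ta_act 1%g x = x.
Proof.
rewrite -[RHS]id_lfunE; congr (fun_of_lfun _ _); apply: basis_eq => v.
by rewrite ta_actE cl1_lambda scale1r cl1_T id_lfunE.
Qed.

Lemma ta_actM g h x : ta_act (g * h)%g x = ta_act g (ta_act h x).
Proof.
rewrite -[RHS]comp_lfunE; congr (fun_of_lfun _ _); apply: basis_eq => v.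
rewrite comp_lfunE; apply: etrans (ta_actE _ _) _.
apply/esym/(etrans (congr1 (ta_act g) (ta_actE h v))); rewrite linearZ.
apply: etrans (congr1 ( *:%R (cl_lambda h v)) (ta_actE g _)) _.
by rewrite clM_lambda clM_T scalerA mulrC.
Qed.

Definition ta_rep : rep C (clifford C A) := Rep ta_act1 ta_actM.

Definition ta_mul_lfun : 'Hom(tensor CV CV, CV) :=
  basis_ext2 (fun v w => beta v w *: tw (v + w)).

Lemma ta_mul_lfunE v w : ta_mul_lfun (tens (tw v) (tw w)) = beta v w *: tw (v + w).
Proof. exact: basis_ext2E. Qed.

Lemma ta_mul_subproof g x :
  ta_mul_lfun (rep_act (rep_tens ta_rep ta_rep) g x) = rep_act ta_rep g (ta_mul_lfun x).
Proof.
rewrite -!comp_lfunE; congr (fun_of_lfun _ _); apply: basis_eq2 => v w.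
rewrite !comp_lfunE /= tens_mapE ta_mul_lfunE !ta_actE tensZl tensZr !linearZ /=.
rewrite ta_mul_lfunE ta_actE !scalerA zautD; congr (_ *: _).
by rewrite [RHS]mulrC cl_cocycle -[RHS]mulrA [RHS]mulrC.
Qed.

Definition ta_mul : rep_hom (rep_tens ta_rep ta_rep) ta_rep :=
  @RepHom _ _ (rep_tens ta_rep ta_rep) ta_rep ta_mul_lfun ta_mul_subproof.

Definition ta_one_lfun : 'Hom(C^o, CV) := unit_ext (tw 0).

Lemma ta_one_lfunE (c : C^o) : ta_one_lfun c = c *: tw 0.
Proof. exact: unit_extE. Qed.

Lemma ta_one_subproof g x :
  ta_one_lfun (rep_act (rep_unit C (clifford C A)) g x) = rep_act ta_rep g (ta_one_lfun x).
Proof.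
by rewrite /= id_lfunE ta_one_lfunE linearZ /= ta_actE cl_lambda0 zaut0 scale1r.
Qed.

Definition ta_one : rep_hom (rep_unit C (clifford C A)) ta_rep :=
  @RepHom _ _ (rep_unit C (clifford C A)) ta_rep ta_one_lfun ta_one_subproof.

Lemma ta_mulA :
  rep_comp ta_mul (hom_tens ta_mul (rep_id ta_rep)) =
  rep_comp ta_mul (rep_comp (hom_tens (rep_id ta_rep) ta_mul)
                            (rep_assoc ta_rep ta_rep ta_rep)).
Proof.
apply: rep_hom_inj; apply: basis_eq3 => u v w /=.
rewrite !comp_lfunE tens_assocE !tens_mapE !id_lfunE !ta_mul_lfunE tensZl tensZr.
rewrite !linearZ /= !ta_mul_lfunE !scalerA addrA betaDl betaDr; congr (_ *: _).
by rewrite mulrA mulrC.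
Qed.

Lemma ta_mul1l : rep_comp ta_mul (hom_tens ta_one (rep_id ta_rep)) = rep_lunit ta_rep.
Proof.
apply: rep_hom_inj; apply: tens_ext => c x /=.
rewrite comp_lfunE tens_mapE id_lfunE tens_lunitE ta_one_lfunE tensZl linearZ /=.
congr (_ *: _); rewrite [x in LHS](free_spaceE x) tens_sumr linear_sum.
rewrite [RHS](free_spaceE x); apply: eq_bigr => v _.
by rewrite tensZr linearZ /= ta_mul_lfunE add0r beta0l scale1r.
Qed.

Lemma ta_mul1r : rep_comp ta_mul (hom_tens (rep_id ta_rep) ta_one) = rep_runit ta_rep.
Proof.
apply: rep_hom_inj; apply: tens_ext => x c /=.
rewrite comp_lfunE tens_mapE id_lfunE tens_runitE ta_one_lfunE tensZr linearZ /=.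
congr (_ *: _); rewrite [x in LHS](free_spaceE x) tens_suml linear_sum.
rewrite [RHS](free_spaceE x); apply: eq_bigr => v _.
by rewrite tensZl linearZ /= ta_mul_lfunE addr0 beta0r scale1r.
Qed.

Definition twisted_algebra : alg_obj C (clifford C A) := AlgObj ta_mulA ta_mul1l ta_mul1r.

End Algebras.

(* Main.v *)
Require Import Defs.
From mathcomp Require Import all_boot all_order all_algebra all_fingroup.
From mathcomp Require Import reals complex.

Set Implicit Arguments.
Unset Strict Implicit.
Unset Printing Implicit Defensive.

Import Order.TTheory GRing.Theory Num.Theory.
Local Open Scope ring_scope.

(** The functor F keeps the underlying space of a representation, and here both
    algebras live on the space with basis V_A, so the isomorphism is the identity
    map.  What has to be seen is that the two structures agree on basis vectors,
    and everything follows from the weight of delta_v: since (id, chi) scales it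
    by chi(v), the vector delta_v lies in the weight space of index v
    ([delta_weight]).  On that space, F lets (T, lambda) act by lambda(v) rho(T),
    while rho(T) delta_v = delta_(Tv); this is alpha_g ([F_act_ga]).  On the
    tensor product of the weight spaces of v and w, the tensor structure J is the
    scalar beta(v, w), so composing it with the untwisted product yields the
    twisted one ([F_mul_ga]).  The unit constraint of F is the identity and both
    units are the basis vector of index 0, which settles the unit axiom. *)

Section TwistedGroupAlgebra.
Variables (C : numClosedFieldType) (A : finZmodType).
Implicit Types (v w : VA C A) (g : clifford C A).

Local Notation CV := (group_algebra C A).
Local Notation tA := (twisted_algebra C A).

Lemma delta_weight v : delta v \in weight (ga_rep C A) v.
Proof. by apply/weightP => chi; rewrite /act_char /= ga_actE sympl1E. Qed.

Lemma F_act_delta g v :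
  F_act (ga_rep C A) g (delta v) = cl_lambda g v *: delta (cl_T g v).
Proof.
rewrite (F_actE _ (delta_weight v)) /rho /= ga_actE.
(* rho(T) is the action of (T, 1), and the trivial character contributes 1 *)
by rewrite dual0E scale1r.
Qed.

Lemma F_act_ga g : F_act (ga_rep C A) g = ta_act g.
Proof.
by apply: basis_eq => v; apply: etrans (F_act_delta g v) (esym (ta_actE g v)).
Qed.

Lemma F_mul_delta v w :
  F_mul CV (tens (delta v) (delta w)) = beta v w *: delta (v + w).
Proof.
rewrite /= comp_lfunE (J_lfunE (delta_weight v) (delta_weight w)) linearZ /=.
by rewrite ga_mul_lfunE.
Qed.

Lemma F_mul_ga t : F_mul CV t = ta_mul_lfun C A t.
Proof.
congr (fun_of_lfun _ _); apply: basis_eq2 => v w.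
by apply: etrans (F_mul_delta v w) (esym (ta_mul_lfunE v w)).
Qed.

(** F leaves carriers unchanged, so the carriers of F(C[V_A]) and of the twisted
    algebra are convertible and the identity is well typed in both directions;
    the content is its equivariance. *)
Lemma twist_hom_subproof g (x : F_alg CV) :
  (\1%VF : 'Hom(F_alg CV, tA)) (rep_act (F_alg CV) g x) =
  rep_act tA g ((\1%VF : 'Hom(F_alg CV, tA)) x).
Proof. by rewrite !id_lfunE /= F_act_ga. Qed.

Lemma twist_inv_subproof g (x : tA) :
  (\1%VF : 'Hom(tA, F_alg CV)) (rep_act tA g x) =
  rep_act (F_alg CV) g ((\1%VF : 'Hom(tA, F_alg CV)) x).
Proof. by rewrite !id_lfunE /= F_act_ga. Qed.

Definition twist_hom : rep_hom (F_alg CV) tA :=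
  @RepHom _ _ (F_alg CV) tA \1%VF twist_hom_subproof.

Definition twist_inv : rep_hom tA (F_alg CV) :=
  @RepHom _ _ tA (F_alg CV) \1%VF twist_inv_subproof.

Lemma twist_homK : rep_comp twist_inv twist_hom = rep_id (F_alg CV).
Proof. by apply/rep_hom_inj/lfunP => x; rewrite /= comp_lfunE !id_lfunE. Qed.

Lemma twist_invK : rep_comp twist_hom twist_inv = rep_id tA.
Proof. by apply/rep_hom_inj/lfunP => x; rewrite /= comp_lfunE !id_lfunE. Qed.

Lemma twist_mul :
  rep_comp twist_hom (alg_mul (F_alg CV)) =
  rep_comp (alg_mul tA) (hom_tens twist_hom twist_hom).
Proof.
apply: rep_hom_inj; apply: tens_ext => x y.
rewrite [LHS]comp_lfunE [RHS]comp_lfunE tens_mapE !id_lfunE.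
exact: F_mul_ga.
Qed.

Lemma twist_one : rep_comp twist_hom (alg_one (F_alg CV)) = alg_one tA.
Proof. by apply/rep_hom_inj/lfunP => c; rewrite /= !comp_lfunE !id_lfunE. Qed.

Definition twist_iso : alg_iso (F_alg CV) tA :=
  AlgIso twist_homK twist_invK twist_mul twist_one.

End TwistedGroupAlgebra.

Theorem theorem5p1 (R : realType) (A : finZmodType) :
  let CV := group_algebra R[i] A in
  let FCV := F_alg CV in
  let tA := twisted_algebra R[i] A in
  let m_F := rep_comp (F_hom (alg_mul CV)) (J CV CV) in
  alg_mul FCV = m_F /\
  (forall v w : VA R[i] A,
     m_F (tens (delta v) (delta w)) = beta v w *: delta (v + w)) /\
  exists Phi : alg_iso FCV tA,
    [/\ forall v : VA R[i] A, Phi (delta v) = tw v,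
        forall v : VA R[i] A, iso_inv Phi (tw v) = delta v,
        forall v w : VA R[i] A,
          Phi (m_F (tens (iso_inv Phi (tw v)) (iso_inv Phi (tw w)))) =
            alg_mul tA (tens (tw v) (tw w)) /\
          alg_mul tA (tens (tw v) (tw w)) = beta v w *: tw (v + w)
      & forall (g : clifford R[i] A) (v : VA R[i] A),
          Phi (rep_act FCV g (iso_inv Phi (tw v))) =
            cl_lambda g v *: tw (cl_T g v)].
Proof.
move=> CV FCV tA m_F; split=> //; split; first exact: F_mul_delta.
have PhiE (x : FCV) : twist_iso R[i] A x = x by rewrite id_lfunE.
have invE (y : tA) : iso_inv (twist_iso R[i] A) y = y by rewrite id_lfunE.
exists (twist_iso R[i] A); split=> [v|v|v w|g v]; rewrite ?PhiE ?invE //.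
  split; last exact: ta_mul_lfunE.
  exact: etrans (F_mul_delta v w) (esym (ta_mul_lfunE v w)).
exact: F_act_delta.
Qed.
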